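(* Let $G$ be a finite group acting on a finite set $X$. Let $[H_1], [H_2], \dots, [H_r]$ be the list of different conjugacy classes of subgroups in $\mathrm{Conj}_G(X)=\{[G_x] : x\in X\}$. For each $i$ let $N_i := N_G(H_i)$, and for any $K \leq G$ consider the $N_i$-conjugacy class $[K]_{N_i} := \{ gKg^{-1} : g \in N_i \}$. Then \[ \mathrm{Rank}( \mathrm{End}_G(X) : \mathrm{Aut}_G(X) ) = \sum_{i=1}^r \vert U(H_i) \vert - \kappa_G(X), \] where $U(H_i) := \{ [G_x]_{N_i} : x \in X,\ H_i \leq G_x \}$ and $\kappa_G(X) := \vert \{ i : \vert \mathcal{O}_{[H_i]} \vert = 1 \} \vert$.
   Context: For a group $G$ acting on a set $X$, $Gx$ denotes the orbit and $G_x$ the stabilizer of $x\in X$. $\mathrm{End}_G(X)$ is the monoid, under composition, of all $G$-equivariant maps $\tau:X\to X$ (i.e. $\tau(g\cdot x)=g\cdot\tau(x)$ for all $g\in G$, $x\in X$), and $\mathrm{Aut}_G(X)$ is its group of units (equivalently, the bijective $G$-equivariant maps). For $H\le G$, $[H]=\{gHg^{-1}: g\in G\}$ is its conjugacy class and $N_G(H)$ its normalizer. $\mathcal{O}_{[H]}$ is the set of $G$-orbits $Gx\subseteq X$ with $[G_x]=[H]$. For a monoid $M$ and a subset $N\subseteq M$, the relative rank of $M$ modulo $N$ is $\mathrm{Rank}(M:N):=\min\{|W| : W\subseteq M,\ \langle W\cup N\rangle = M\}$, where $\langle\cdot\rangle$ denotes the generated submonoid. *)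

(* Defs.v *)
From HB Require Import structures.
From mathcomp Require Import all_boot all_order all_algebra all_fingroup.

Set Implicit Arguments.
Unset Strict Implicit.
Unset Printing Implicit Defensive.

Import GroupScope.

Section RelativeRank.

(* The finite monoid (M, op, e). *)
Variables (M : finType) (e : M) (op : Monoid.law e).

Definition is_submonoid (S : {set M}) : bool :=
  (e \in S) && [forall x in S, forall y in S, op x y \in S].

Definition submonoid_gen (A : {set M}) : {set M} :=
  \bigcap_(S : {set M} | is_submonoid S && (A \subset S)) S.

(* The default setT of the arg min satisfies the condition, so this is a     *)
(* genuine minimum (see relative_rankP).                                     *)
Definition relative_rank (N : {set M}) : nat :=
  #|[arg min_(W < [set: M] | submonoid_gen (W :|: N) == [set: M]) #|W| ]|.

Definition monoid_units : {set M} :=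
  [set x | [exists y, (op x y == e) && (op y x == e)]].

Lemma relative_rankP (N : {set M}) :
  (exists2 W : {set M}, submonoid_gen (W :|: N) = [set: M]
                      & #|W| = relative_rank N)
  /\ (forall W : {set M},
        submonoid_gen (W :|: N) = [set: M] -> relative_rank N <= #|W|).
Proof.
rewrite /relative_rank; case: arg_minnP => [|W /eqP genW minW].
  rewrite setTU eqEsubset subsetT; apply/bigcapsP=> S /andP[_ sTS].
  exact: sTS.
by split=> [|V genV]; [exists W | apply: minW; rewrite genV].
Qed.

End RelativeRank.

Section EquivariantMaps.

Variables (gT : finGroupType) (G : {group gT}) (X : finType) (to : action G X).

(* MathComp actions are right actions: to x g stands for g^-1 . x. Passing   *)
(* between left and right actions in this way leaves orbits, stabilizers and *)
(* the equivariance condition unchanged.                                     *)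
Definition equivariant (f : X -> X) : bool :=
  [forall g in G, forall x, f (to x g) == to (f x) g].

Record equivariant_map :=
  EquivariantMap { efun :> {ffun X -> X}; _ : equivariant efun }.

HB.instance Definition _ := [isSub for efun].
HB.instance Definition _ := [Finite of equivariant_map by <:].

Lemma equivariantP (f : X -> X) :
  reflect {in G, forall g x, f (to x g) = to (f x) g} (equivariant f).
Proof.
apply: (iffP forall_inP) => fG g /fG; first by move/forallP=> fg x; apply/eqP.
by move=> fg; apply/forallP=> x; apply/eqP.
Qed.

Lemma equivariant_id : equivariant [ffun x : X => x].
Proof. by apply/equivariantP=> g _ x; rewrite !ffunE. Qed.

Lemma equivariant_comp (f h : equivariant_map) :
  equivariant [ffun x => f (h x)].
Proof.
apply/equivariantP=> g Gg x; rewrite !ffunE.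
by rewrite (equivariantP _ (valP h)) ?(equivariantP _ (valP f)).
Qed.

Definition equi_one := EquivariantMap equivariant_id.
Definition equi_comp f h := EquivariantMap (equivariant_comp f h).

Fact equi_compA : associative equi_comp.
Proof. by move=> f g h; apply/val_inj/ffunP=> x; rewrite !ffunE. Qed.

Fact equi_comp1f : left_id equi_one equi_comp.
Proof. by move=> f; apply/val_inj/ffunP=> x; rewrite !ffunE. Qed.

Fact equi_compf1 : right_id equi_one equi_comp.
Proof. by move=> f; apply/val_inj/ffunP=> x; rewrite !ffunE. Qed.

HB.instance Definition _ :=
  Monoid.isLaw.Build equivariant_map equi_one equi_comp
    equi_compA equi_comp1f equi_compf1.

Definition EndG : Monoid.law equi_one := equi_comp.

Definition AutG : {set equivariant_map} := monoid_units EndG.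

(* [H] is rendered as H :^: G, a set of subsets of gT.                       *)
Definition ConjG : {set {set {set gT}}} := [set 'C_G[x | to] :^: G | x : X].

Definition orbits_of_type (H : {set gT}) : {set {set X}} :=
  [set orbit to G x | x : X & 'C_G[x | to] :^: G == H :^: G].

Definition Uset (H : {set gT}) : {set {set {set gT}}} :=
  [set 'C_G[x | to] :^: 'N_G(H) | x : X & H \subset 'C_G[x | to]].

Definition kappa (r : nat) (H : 'I_r -> {group gT}) : nat :=
  #|[set i | #|orbits_of_type (H i)| == 1%N]|.

End EquivariantMaps.

(* Main.v *)
(* Call a map collapsing one orbit Gx onto a point y outside Gx with          *)
(* G_x <= G_y, and fixing everything else, an elementary collapse.  Its type  *)
(* is the pair ([G_x], [G_y]_N) with N = N_G(G_x).                            *)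
(*                                                                            *)
(* Upper bound.  Every non-surjective equivariant map factors through an      *)
(* elementary collapse and a map with fewer moved points, so automorphisms    *)
(* and elementary collapses generate; two elementary collapses of the same    *)
(* type are conjugate under Aut_G(X), so one per type suffices.               *)
(*                                                                            *)
(* Lower bound.  Say that f has type t if its kernel is the kernel of an      *)
(* elementary collapse of type t.  The type is determined by f, automorphisms *)
(* have none, and if f1 o f2 has type t then so does f1 or f2.  Hence the     *)
(* maps that are not of type t form a proper submonoid containing Aut_G(X),   *)
(* and a generating set must contain a map of each type.                      *)

Require Import Defs.
From HB Require Import structures.
From mathcomp Require Import all_boot all_order all_algebra all_fingroup.

Set Implicit Arguments.
Unset Strict Implicit.
Unset Printing Implicit Defensive.

(** Both bounds meet at the number of elements of [collapse_types]: [collapses_generate] and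
    [collapse_same_type] carry the upper one, [collapses_comp] and [collapses_uniq] the lower one. A
    pair ([H_i], [K]_{N_i}) with [K]_{N_i} in U(H_i) is the type of a collapse unless K = H_i and
    only one orbit has type [H_i], since a collapse needs a second orbit. This exception removes one
    pair for each index counted by kappa ([card_collapse_types]). *)

Section GeneratedSubmonoid.

Variables (M : finType) (e : M) (op : Monoid.law e).

Lemma submonoidP (S : {set M}) :
  reflect (e \in S /\ {in S &, forall x y, op x y \in S}) (is_submonoid op S).
Proof.
apply: (iffP andP) => -[Se SM]; split=> //.
  by move=> x y Sx Sy; move/forall_inP/(_ x Sx)/forall_inP/(_ y Sy): SM.
by apply/forall_inP=> x Sx; apply/forall_inP=> y Sy; apply: SM.
Qed.

Lemma submonoid_gen_min (A S : {set M}) :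
  is_submonoid op S -> A \subset S -> submonoid_gen op A \subset S.
Proof. by move=> SM AS; apply: bigcap_inf; rewrite SM. Qed.

Lemma submonoid_gen_fullP (A : {set M}) :
  (forall S : {set M}, is_submonoid op S -> A \subset S -> S = [set: M]) ->
  submonoid_gen op A = [set: M].
Proof.
move=> full; apply/eqP; rewrite eqEsubset subsetT.
by apply/bigcapsP=> S /andP[SM AS]; rewrite (full S SM AS).
Qed.

End GeneratedSubmonoid.

Section EquivariantMonoid.

Local Open Scope group_scope.

Context {gT : finGroupType} {G : {group gT}} {X : finType}.
Variable to : action G X.

Local Notation stab x := ('C_G[x | to]).
Local Notation orb x := (orbit to G x).
Local Notation End := (equivariant_map to).

Implicit Types (x y z : X) (g h : gT) (f : equivariant_map to).

(** * Stabilizers, orbits and equivariant maps *)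

Lemma conjugates_eqP (N : {group gT}) (A B : {set gT}) :
  reflect (exists2 n, n \in N & B = A :^ n) (A :^: N == B :^: N).
Proof.
apply: (iffP eqP) => [eqAB | [n Nn ->]]; last first.
  by rewrite -!orbitJs orbit_act.
suff /imsetP[n Nn ->]: B \in A :^: N by exists n.
by rewrite eqAB; apply/imsetP; exists 1; rewrite ?group1 ?conjsg1.
Qed.

Lemma mem_stab x g : (g \in stab x) = (g \in G) && (to x g == x).
Proof.
by rewrite !inE sub1set inE; case: (g \in G).
Qed.

Lemma stab_act x g : g \in G -> stab (to x g) = stab x :^ g.
Proof. by move=> Gg; rewrite conjIg conjGid // astab1_act_in. Qed.

(** This makes the assignment of [to y g] to [to x g] well defined: [g * h^-1] fixes [x], hence
    [y]. *)
Lemma stab_sub_act x y g h :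
  stab x \subset stab y -> g \in G -> h \in G -> to x g = to x h ->
  to y g = to y h.
Proof.
move=> /subsetP sxy Gg Gh eq_gh.
suff /sxy: g * h^-1 \in stab x.
  rewrite mem_stab groupMr ?groupV // Gg actMin ?groupV //= => /eqP.
  by move/(congr1 (to^~ h)); rewrite actKVin.
by rewrite mem_stab groupMr ?groupV // Gg actMin ?groupV // eq_gh actKin /=.
Qed.

Lemma stab_sub_conj x y g :
  g \in G -> stab x \subset stab y -> stab (to x g) \subset stab (to y g).
Proof. by move=> Gg sxy; rewrite !stab_act // conjSg. Qed.

Lemma orb_act x y g : g \in G -> (to y g \in orb x) = (y \in orb x).
Proof. by move=> Gg; rewrite !(orbit_in_sym to (subxx G) _ x) orbit_act_in. Qed.

Lemma orb_act_base x y g : g \in G -> (y \in orb (to x g)) = (y \in orb x).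
Proof. by move=> Gg; rewrite orbit_act_in. Qed.

Lemma orb_sym x y : (x \in orb y) = (y \in orb x).
Proof. exact: orbit_in_sym. Qed.

Lemma orb_trans y x z : x \in orb y -> y \in orb z -> x \in orb z.
Proof. exact: orbit_in_trans. Qed.

Lemma card_stab_orb x y : y \in orb x -> #|stab y| = #|stab x|.
Proof. by case/orbitP=> g Gg <-; rewrite stab_act // cardJg. Qed.

Lemma stab_orb_eq x y : y \in orb x -> stab x \subset stab y -> stab x = stab y.
Proof. by move=> oxy sxy; apply/eqP; rewrite eqEcard sxy (card_stab_orb oxy) /=. Qed.

Lemma efun_act f g x : g \in G -> f (to x g) = to (f x) g.
Proof. by move=> Gg; apply: (equivariantP _ _ (valP f)). Qed.

Lemma efun_stab f x : stab x \subset stab (f x).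
Proof.
apply/subsetP=> g; rewrite !mem_stab => /andP[Gg /eqP xg].
by rewrite Gg -efun_act ?xg /=.
Qed.

Lemma efun_orb f x y : y \in orb x -> f y \in orb (f x).
Proof. by case/orbitP=> g Gg <-; rewrite efun_act // mem_orbit. Qed.

Lemma efun_comp f1 f2 x : EndG to f1 f2 x = f1 (f2 x).
Proof. by rewrite /= ffunE. Qed.

Lemma equi_oneE x : equi_one to x = x.
Proof. by rewrite ffunE. Qed.

Lemma efun_eq f1 f2 : f1 =1 f2 -> f1 = f2.
Proof. by move=> eqf; apply/val_inj/ffunP. Qed.

Lemma AutGP f : reflect (injective f) (f \in AutG to).
Proof.
rewrite inE; apply: (iffP existsP) => [[f' /andP[_ /eqP f'f]] | injf].
  apply: (can_inj (g := f')) => x.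
  by rewrite -[f' _]efun_comp f'f equi_oneE.
have eqf': equivariant to [ffun x => invF injf x].
  apply/equivariantP=> g Gg x; rewrite !ffunE.
  by apply: (injf); rewrite efun_act // !f_invF.
exists (EquivariantMap eqf'); apply/andP.
by split; apply/eqP/efun_eq=> x; rewrite efun_comp !ffunE ?f_invF ?invF_f.
Qed.

Lemma aut_stab f x : f \in AutG to -> stab (f x) = stab x.
Proof.
move=> /AutGP injf; apply/esym/eqP; rewrite eqEsubset efun_stab.
apply/subsetP=> g; rewrite !mem_stab => /andP[Gg /eqP fxg].
by rewrite Gg; apply/eqP/injf; rewrite efun_act.
Qed.

Lemma aut_orb f x y : f \in AutG to -> (f y \in orb (f x)) = (y \in orb x).
Proof.
move=> /AutGP injf; apply/idP/idP; last exact: efun_orb.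
by case/orbitP=> g Gg; rewrite -efun_act // => /injf <-; apply: mem_orbit.
Qed.

(** * Elementary collapses and their conjugacy *)

Definition collapse_fun x y z :=
  if [pick g in G | to x g == z] is Some g then to y g else z.

Lemma collapse_fun_act x y g :
  stab x \subset stab y -> g \in G -> collapse_fun x y (to x g) = to y g.
Proof.
rewrite /collapse_fun => sxy Gg; case: pickP => [h /andP[Gh /eqP eq_hg] | /(_ g)].
  exact: (stab_sub_act sxy).
by rewrite Gg eqxx.
Qed.

Lemma collapse_fun_out x y z : z \notin orb x -> collapse_fun x y z = z.
Proof.
rewrite /collapse_fun; case: pickP => // g /andP[Gg /eqP <-].
by rewrite mem_orbit.
Qed.

Lemma collapse_fun_equi x y :
  stab x \subset stab y -> equivariant to [ffun z => collapse_fun x y z].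
Proof.
move=> sxy; apply/equivariantP=> g Gg z; rewrite !ffunE.
have [/orbitP[h Gh <-] | nxz] := boolP (z \in orb x).
  by rewrite -actMin // !collapse_fun_act ?groupM // actMin.
by rewrite !collapse_fun_out ?orb_act.
Qed.

(* Junk value: the identity, when [stab x] is not a subgroup of [stab y].     *)
Definition collapse x y : End :=
  insubd (equi_one to) [ffun z => collapse_fun x y z].

Lemma collapseE x y z : stab x \subset stab y -> collapse x y z = collapse_fun x y z.
Proof.
move=> sxy; rewrite /collapse -[efun _]/(val _) insubdK ?ffunE //.
exact: collapse_fun_equi.
Qed.

Lemma collapse_act x y g :
  stab x \subset stab y -> g \in G -> collapse x y (to x g) = to y g.
Proof. by move=> sxy Gg; rewrite collapseE ?collapse_fun_act. Qed.

Lemma collapse_base x y : stab x \subset stab y -> collapse x y x = y.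
Proof. by move=> sxy; have := collapse_act sxy (group1 G); rewrite !act1. Qed.

Lemma collapse_out x y z :
  stab x \subset stab y -> z \notin orb x -> collapse x y z = z.
Proof. by move=> sxy nxz; rewrite collapseE ?collapse_fun_out. Qed.

(** A collapse depends only on the [G]-orbit of the pair, so [x] may be moved to a point with a
    prescribed conjugate stabilizer. *)
Lemma collapse_conj x y g :
  stab x \subset stab y -> g \in G -> collapse (to x g) (to y g) = collapse x y.
Proof.
move=> sxy Gg; apply: efun_eq => z.
have sxyg := stab_sub_conj Gg sxy.
have [/orbitP[h Gh <-] | nxz] := boolP (z \in orb x); last first.
  by rewrite !collapse_out ?orb_act_base.
have Ggh : g^-1 * h \in G by rewrite groupM ?groupV.
have := collapse_act sxyg Ggh.
by rewrite !actMin ?groupV // !actKin // collapse_act.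
Qed.

Lemma aut_swap p q : stab p = stab q ->
  exists2 a, a \in AutG to &
    a p = q /\ forall z, z \notin orb p -> z \notin orb q -> a z = z.
Proof.
move=> eq_pq; have sub_pq: stab p \subset stab q by rewrite eq_pq.
have sub_qp: stab q \subset stab p by rewrite eq_pq.
(* For distinct orbits this swaps them. If [p] and [q] share an orbit, only the first branch acts on
   it, so the inverse is [s q p] rather than [s p q]. *)
pose s p q z := if z \in orb p then collapse p q z else collapse q p z.
have sK p' q' : stab p' = stab q' -> cancel (s p' q') (s q' p').
  move=> eq' z; rewrite /s.
  have [s1 s2] : stab p' \subset stab q' /\ stab q' \subset stab p' by rewrite eq'.
  have [/orbitP[g Gg <-] | npz] := boolP (z \in orb p').
    by rewrite collapse_act // mem_orbit // collapse_act.
  have [/orbitP[g Gg def_z] | nqz] := boolP (z \in orb q').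
    rewrite -def_z collapse_act // ; case: ifP => [oq | _].
      move: npz; rewrite -def_z orb_act //; case/negP.
      by rewrite orb_sym -(orb_act _ _ Gg).
    by rewrite collapse_act.
  by rewrite !collapse_out // (negPf nqz).
have s_equi: equivariant to [ffun z => s p q z].
  apply/equivariantP=> g Gg z; rewrite !ffunE /s orb_act //.
  by case: ifP; rewrite efun_act.
exists (EquivariantMap s_equi).
  by apply/AutGP=> z1 z2; rewrite !ffunE; apply: (can_inj (sK _ _ eq_pq)).
split=> [|z nz1 nz2]; rewrite ffunE /s ?orbit_refl ?collapse_base //.
by rewrite (negPf nz1) collapse_out.
Qed.

(** An automorphism [a] sending [x0] to [x] and [y0] to [y] conjugates one collapse to the other. It
    is built in two swaps: the second corrects the image of [y0] without moving [x], because it acts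
    only off the orbit of [x]. *)
Lemma collapse_same_type x0 y0 x y :
  y0 \notin orb x0 -> y \notin orb x -> stab x \subset stab y ->
  stab x0 = stab x -> stab y0 = stab y ->
  exists a b, [/\ a \in AutG to, b \in AutG to
    & collapse x y = EndG to a (EndG to (collapse x0 y0) b)].
Proof.
move=> n0 n1 sxy eqx eqy.
have [a1 Aa1 [a1x _]] := aut_swap eqx; have /AutGP a1inj := Aa1.
pose y1 := a1 y0.
have stab_y1 : stab y1 = stab y by rewrite aut_stab.
have ny1 : y1 \notin orb x by rewrite -a1x aut_orb.
have [a2 /AutGP a2inj [a2y a2fix]] := aut_swap stab_y1.
have a2x : a2 x = x by rewrite a2fix // orb_sym.
pose a := EndG to a2 a1.
have aE z : a z = a2 (a1 z) by apply: efun_comp.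
have ainj : injective a by move=> u v; rewrite !aE => /a2inj/a1inj.
have ax : a x0 = x by rewrite aE a1x.
have ay : a y0 = y by rewrite aE.
clearbody a.
have /AutGP Aa := ainj.
have := Aa; rewrite inE => /existsP[b /andP[/eqP ab _]].
have abE z : a (b z) = z by rewrite -[LHS]efun_comp ab equi_oneE.
have sxy0 : stab x0 \subset stab y0 by rewrite eqx eqy.
exists a, b; split; [exact: Aa | exact/AutGP/(can_inj abE) | ].
apply: efun_eq => z; rewrite !efun_comp -{1}(abE z).
move: (b z) => {}z; have [/orbitP[g Gg <-]|nz] := boolP (z \in orb x0).
  by rewrite collapse_act // !efun_act // ax ay collapse_base.
by rewrite !collapse_out // -ax aut_orb.
Qed.

(** * Generation by automorphisms and collapses *)

(* If [x] is not in the image of [f], then [f] is the collapse of [x] onto    *)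
(* [f x] after the map that fixes the orbit of [x] and agrees with [f]        *)
(* elsewhere; the latter has fewer moved points.                              *)
Lemma collapses_generate (S : {set End}) :
  is_submonoid (EndG to) S -> AutG to \subset S ->
  (forall x y, y \notin orb x -> stab x \subset stab y -> collapse x y \in S) ->
  S = [set: End].
Proof.
move=> /submonoidP[_ SM] /subsetP SA Scol; apply/setP=> f; rewrite [RHS]inE.
have [n] := ubnP #|[set z | f z != z]|; elim: n => // n IHn in f *.
rewrite ltnS => le_n.
have [|/injectivePn] := boolP (injectiveb f); first by move/injectiveP/AutGP/SA.
case=> u [v neq_uv eq_f].
have /existsP[x x_out]: [exists x, x \notin codom f].
  apply: contraT; rewrite negb_exists => /forallP sur.
  have /image_injP f_inj: #|codom f| == #|X|.
    by apply/eqP/eq_card => z; rewrite (negbNE (sur z)).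
  by case/negP: neq_uv; apply/eqP/f_inj.
have nox z : f z \notin orb x.
  apply: contra x_out; rewrite orb_sym => /orbitP[g Gg def_x].
  by rewrite -def_x -efun_act // codom_f.
have f'_equi: equivariant to [ffun z => if z \in orb x then z else f z].
  apply/equivariantP=> g Gg z; rewrite !ffunE orb_act //.
  by case: ifP; rewrite ?efun_act.
pose f' := EquivariantMap f'_equi.
have sub_x : stab x \subset stab (f x) by apply: efun_stab.
have -> : f = EndG to (collapse x (f x)) f'.
  apply: efun_eq => z; rewrite efun_comp ffunE.
  case: ifPn => [/orbitP[g Gg <-] | nz]; first by rewrite collapse_act ?efun_act.
  by rewrite collapse_out.
apply: SM; first exact: Scol.
apply: IHn; apply: leq_trans le_n; apply: proper_card; apply/properP; split.
  by apply/subsetP=> z; rewrite !inE ffunE; case: ifP; rewrite ?eqxx.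
exists x; rewrite !inE ?ffunE ?orbit_refl ?eqxx //.
by apply: contra (nox x) => /eqP->; apply: orbit_refl.
Qed.

(** * Kernels and types of maps *)

(* An injection of the finite set of orbits is periodic, so some iterate of   *)
(* [f] maps every orbit to itself, and stabilizers cannot grow along the way. *)
Lemma efun_inj_orbits f :
  (forall u v, f u \in orb (f v) -> u \in orb v) -> injective f.
Proof.
move=> f_orb u v eq_f.
have imf x : f @: orb x = orb (f x).
  apply/setP=> z; apply/imsetP/orbitP=> [[_ /orbitP[g Gg <-] ->] | [g Gg <-]].
    by exists g; rewrite ?efun_act.
  by exists (to x g); rewrite ?mem_orbit ?efun_act.
pose S := [set orb x | x : X].
have SP x : orb x \in S by apply: imset_f.
have homS : {homo (fun A : {set X} => f @: A) : A / A \in S}.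
  by move=> _ /imsetP[x _ ->]; rewrite imf.
have injS : {in S &, injective (fun A : {set X} => f @: A)}.
  move=> _ _ /imsetP[x _ ->] /imsetP[y _ ->]; rewrite !imf => eq_orb.
  by apply/orbit_in_eqP/f_orb => //; rewrite -eq_orb orbit_refl.
have := iter_order_in homS injS (SP v).
(* A positive period [n.+1] makes the iteration pass through [f v] before it returns to the orbit of
   [v]. *)
have := fingraph.order_gt0 (fun A : {set X} => f @: A) (orb v).
case: (fingraph.order _ _) => // n _ iterv.
have iter_orb m : iter m (fun A : {set X} => f @: A) (orb v) = orb (iter m f v).
  by elim: m => //= m ->; rewrite imf.
have iter_stab m : stab (f v) \subset stab (iter m.+1 f v).
  by elim: m => //= m IHm; apply: subset_trans IHm (efun_stab _ _).
have v_iter : iter n.+1 f v \in orb v by rewrite -iterv iter_orb orbit_refl.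
have eq_stab : stab (f v) = stab v.
  apply/esym/eqP; rewrite eqEcard efun_stab -(card_stab_orb v_iter).
  exact: subset_leq_card.
have /orbitP[g Gg def_u]: u \in orb v by apply: f_orb; rewrite eq_f orbit_refl.
have: g \in stab (f v) by rewrite mem_stab Gg -efun_act //= def_u eq_f.
by rewrite eq_stab mem_stab def_u => /andP[_ /eqP].
Qed.

(* Equivalently, the kernel of [f] is the equivariant equivalence relation    *)
(* generated by the single pair [(x, y)].                                     *)
Definition collapses f x y :=
  [&& f x == f y, y \notin orb x, stab x \subset stab y
    & dinjectiveb f (~: orb x)].

Lemma collapsesP f x y :
  reflect [/\ f x = f y, y \notin orb x, stab x \subset stab y
            & forall u v, u \notin orb x -> v \notin orb x -> f u = f v -> u = v]
          (collapses f x y).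
Proof.
apply: (iffP and4P) => -[eqf nxy sxy injf].
  split=> // [|u v nu nv eq_uv]; first exact/eqP.
  by move/dinjectiveP: injf; apply=> //; rewrite inE.
split=> //; first exact/eqP.
by apply/dinjectiveP=> u v; rewrite !inE; apply: injf.
Qed.

Lemma collapses_collapse x y :
  y \notin orb x -> stab x \subset stab y -> collapses (collapse x y) x y.
Proof.
move=> nxy sxy; apply/collapsesP; split=> // [|u v nu nv].
  by rewrite collapse_base ?collapse_out.
by rewrite !collapse_out.
Qed.

Lemma collapses_not_aut f x y : collapses f x y -> f \notin AutG to.
Proof.
case/collapsesP=> eqf nxy _ _; apply/AutGP=> injf.
by rewrite (injf _ _ eqf) orbit_refl in nxy.
Qed.

(** The kernel of [f2] lies in that of the composite, which is minimal: either [f2] already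
    identifies [x] with [y], or it separates orbits and is therefore an automorphism. *)
Lemma collapses_comp f1 f2 x y :
  collapses (EndG to f1 f2) x y ->
  collapses f2 x y \/ f2 \in AutG to /\ collapses f1 (f2 x) (f2 y).
Proof.
case/collapsesP; rewrite !efun_comp => eqf nxy sxy injf.
have [A2 | nA2] := boolP (f2 \in AutG to); [right | left].
  have f2surj u : exists v, u = f2 v.
    by have /AutGP inj2 := A2; exists (invF inj2 u); rewrite f_invF.
  split=> //; apply/collapsesP; split; rewrite ?aut_stab ?aut_orb //.
  move=> u v; have [u' ->] := f2surj u; have [v' ->] := f2surj v.
  rewrite !aut_orb // => nu nv eq_uv; congr (f2 _).
  by apply: injf; rewrite ?efun_comp.
apply/collapsesP; split=> // [|u v nu nv eq_uv]; last first.
  by apply: injf; rewrite ?efun_comp ?eq_uv.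
apply/eqP; apply: contraR nA2 => /eqP neq2; apply/AutGP/efun_inj_orbits.
(* If [to x g] and [v] have the same image, so do [to y g] and [v] under the composite; both avoid
   the orbit of [x], hence agree, and cancelling [g] gives [f2 x = f2 y]. *)
have sep u v : u \in orb x -> v \notin orb x -> f2 u <> f2 v.
  case/orbitP=> g Gg <- nv eq_uv; apply: neq2.
  have /esym def_v : to y g = v.
    by apply: injf; rewrite ?orb_act // !efun_comp -eq_uv !efun_act // eqf.
  by move: eq_uv; rewrite def_v !efun_act // => /act_inj.
move=> u v /orbitP[g Gg]; rewrite -efun_act // => eq_vu.
rewrite -(orb_act_base v u Gg); move: (to v g) eq_vu => {g Gg} {}v eq_vu.
have [ux | nux] := boolP (u \in orb x); have [vx | nvx] := boolP (v \in orb x).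
- by apply: orb_trans ux _; rewrite orb_sym.
- by case: (sep u v ux nvx).
- by case: (sep v u vx nux).
by rewrite (injf u v) ?orbit_refl // !efun_comp eq_vu.
Qed.

Lemma collapses_uniq f x1 y1 x2 y2 :
  collapses f x1 y1 -> collapses f x2 y2 ->
  exists2 g, g \in G & stab x2 = stab x1 :^ g /\ stab y2 = stab y1 :^ g.
Proof.
case/collapsesP=> eqf1 n1 s1 inj1 /collapsesP[eqf2 n2 s2 inj2].
have [/orbitP[g Gg def_x2] | n12] := boolP (x2 \in orb x1).
  exists g; rewrite // -def_x2 -!stab_act //; split=> //; congr (stab _).
  apply: inj1; rewrite -?(orb_act_base x1 y2 Gg) ?def_x2 ?orb_act //.
  by rewrite -eqf2 -def_x2 !efun_act // eqf1.
(* With [x1] and [x2] in different orbits, the two collapses join the same two orbits in opposite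
   directions; comparing orders turns both stabilizer inclusions into equalities. *)
have y2x1 : y2 \in orb x1.
  apply: contraR n2 => ny2; suff <-: x2 = y2 by apply: orbit_refl.
  exact: inj1.
have y1x2 : y1 \in orb x2.
  apply: contraR n1 => ny1; suff <-: x1 = y1 by apply: orbit_refl.
  by apply: inj2; rewrite // orb_sym.
have le1 := subset_leq_card s1; have le2 := subset_leq_card s2.
have c1 := card_stab_orb y1x2; have c2 := card_stab_orb y2x1.
have e1 : stab x1 = stab y1 by apply/eqP; rewrite eqEcard s1 c1 -c2.
have e2 : stab x2 = stab y2 by apply/eqP; rewrite eqEcard s2 c2 -c1.
have /orbitP[g Gg def_y2] := y2x1.
by exists g; rewrite // -e1 e2 -def_y2 stab_act.
Qed.

(* For [H = H i], the index [i] and the class [u] form the pair               *)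
(* ([H_i], [K]_{N_i}) counted by the right-hand side.                         *)
Definition has_type (H : {set gT}) (u : {set {set gT}}) f :=
  [exists x, exists y,
    [&& stab x == H, stab y :^: 'N_G(H) == u & collapses f x y]].

Lemma has_typeP H u f :
  reflect (exists x y, [/\ stab x = H, stab y :^: 'N_G(H) = u & collapses f x y])
          (has_type H u f).
Proof.
apply: (iffP existsP) => [[x /existsP[y /and3P[/eqP ? /eqP ? ?]]] | [x [y [? ? ?]]]].
  by exists x, y.
by exists x; apply/existsP; exists y; apply/and3P; split=> //; apply/eqP.
Qed.

Lemma untyped_submonoid H u : is_submonoid (EndG to) [set f | ~~ has_type H u f].
Proof.
apply/submonoidP; split=> [|f1 f2]; rewrite !inE.
  apply/has_typeP=> -[x [y [_ _ /collapses_not_aut/AutGP[]]]].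
  by move=> z1 z2; rewrite !equi_oneE.
move=> nt1 nt2; apply/has_typeP=> -[x [y [eq_x eq_y /collapses_comp]]].
case=> [col2 | [A2 col1]].
  by case/has_typeP: nt2; exists x, y.
by case/has_typeP: nt1; exists (f2 x), (f2 y); rewrite !aut_stab.
Qed.

(** * Realizable types, the two bounds and the count *)

Section Types.

Variables (r : nat) (H : 'I_r -> {group gT}).
Hypothesis H_distinct : injective (fun i : 'I_r => H i :^: G).
Hypothesis H_list : [set H i :^: G | i : 'I_r] = ConjG to.

(* The pair ([H_i], [H_i]_{N_i}) needs two distinct orbits of type [H_i],     *)
(* which is where the correction [kappa] comes from.                          *)
Definition collapse_types : {set 'I_r * {set {set gT}}} :=
  [set p | (p.2 \in Uset to (H p.1)) &&
    ~~ ((#|orbits_of_type to (H p.1)| == 1%N)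
         && (p.2 == H p.1 :^: 'N_G(H p.1)))].

Lemma stab_conj_repr x (K : {set gT}) :
  stab x :^: G = K :^: G -> exists2 z, z \in orb x & stab z = K.
Proof.
move/eqP/conjugates_eqP=> [g Gg ->].
by exists (to x g); rewrite ?mem_orbit ?stab_act.
Qed.

Lemma stab_repr i : exists x, stab x = H i.
Proof.
have: H i :^: G \in ConjG to by rewrite -H_list; apply/imsetP; exists i.
by case/imsetP=> x _ /esym/stab_conj_repr[z _ <-]; exists z.
Qed.

Lemma mem_orbits_of_type x (K : {set gT}) :
  stab x = K -> orb x \in orbits_of_type to K.
Proof. by move=> <-; apply/imsetP; exists x; rewrite // inE. Qed.

(** In the excluded case [y] also has stabilizer [H i], as ['N_G(H i)] fixes [H i], so the single
    orbit of this type would contain both [x] and [y]. *)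
Lemma mem_collapse_types i x y :
  y \notin orb x -> stab x = H i -> stab x \subset stab y ->
  (i, stab y :^: 'N_G(H i)) \in collapse_types.
Proof.
move=> nxy eq_x sxy; rewrite inE /=; apply/andP; split.
  by apply/imsetP; exists y; rewrite // inE -eq_x.
apply: contra nxy => /andP[/cards1P[O def_O]]; rewrite eq_sym.
case/conjugates_eqP=> n /setIP[_ /normP nH] eq_y; rewrite nH in eq_y.
have := mem_orbits_of_type eq_x; have := mem_orbits_of_type eq_y.
by rewrite def_O !inE => /eqP <- /eqP ->; apply: orbit_refl.
Qed.

Lemma collapse_types_repr p : p \in collapse_types ->
  exists x y, [/\ stab x = H p.1, stab y :^: 'N_G(H p.1) = p.2,
                  y \notin orb x & stab x \subset stab y].
Proof.
case: p => i u /[!inE] /= /andP[/imsetP[y /[!inE] sHy def_u] not_single].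
have [x eq_x] := stab_repr i; exists x.
(* If [y] falls in the orbit of [x], its stabilizer is [H i], and a second orbit of this type
   provides a replacement. *)
have [yx | nyx] := boolP (y \in orb x); last by exists y; rewrite eq_x.
have eq_y : stab y = H i by rewrite -eq_x -(stab_orb_eq yx) ?eq_x.
have {not_single}: #|orbits_of_type to (H i)| != 1%N.
  by apply: contraNN not_single => ->; rewrite def_u eq_y eqxx.
have Ox := mem_orbits_of_type eq_x.
have [/subset_leq_card | /subsetPn[_ /imsetP[z /[!inE] /eqP zH ->] nzx] _] :=
  boolP (orbits_of_type to (H i) \subset [set orb x]).
  rewrite cards1 => le1 /negP[]; rewrite eqn_leq le1.
  by apply/card_gt0P; exists (orb x).
have [y' y'z eq_y'] := stab_conj_repr zH.
exists y'; split; rewrite ?eq_x ?eq_y' //; first by rewrite def_u eq_y.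
apply: contra nzx => y'x; apply/eqP/orbit_in_eqP => //.
by apply: orb_trans y'x; rewrite orb_sym.
Qed.

(** The element [g] from [collapses_uniq] conjugates [H i] to [H j], so [i = j] and [g] normalizes
    [H i]. *)
Lemma has_type_uniq f p q :
  has_type (H p.1) p.2 f -> has_type (H q.1) q.2 f -> p = q.
Proof.
case: p q => [i u] [j v] /= /has_typeP[x1 [y1 [eq_x1 eq_y1 col1]]].
case/has_typeP=> x2 [y2 [eq_x2 eq_y2 col2]].
have [g Gg []] := collapses_uniq col1 col2; rewrite eq_x1 eq_x2 => eqH eqy.
have eq_ij : i = j.
  by apply: H_distinct; apply/eqP/conjugates_eqP; exists g.
move: eqH eq_y2; rewrite -{}eq_ij => eqH <-; rewrite -eq_y1 eqy.
congr (_, _); apply/eqP/conjugates_eqP; exists g => //.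
by rewrite inE Gg; apply/normP.
Qed.

Lemma leq_card_generators (W : {set End}) :
  submonoid_gen (EndG to) (W :|: AutG to) = [set: End] ->
  #|collapse_types| <= #|W|.
Proof.
move=> genW.
(* By [has_type_uniq] the choice is forced, so [type_of] sends [W] onto a set containing all of
   [collapse_types]. *)
pose type_of f := [pick p | has_type (H p.1) p.2 f].
rewrite -(card_imset (mem collapse_types) (@Some_inj _)).
apply: leq_trans (leq_imset_card type_of W).
apply/subset_leq_card/subsetP=> _ /imsetP[p /collapse_types_repr repr_p ->].
have [x [y [eq_x eq_y nxy sxy]]] := repr_p.
have /exists_inP[w Ww wp]: [exists w in W, has_type (H p.1) p.2 w].
  apply: contraT; rewrite negb_exists_in => /forall_inP noW.
  have /subsetP/(_ (collapse x y)): [set: End] \subset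
      [set f | ~~ has_type (H p.1) p.2 f].
    rewrite -genW; apply: submonoid_gen_min; first exact: untyped_submonoid.
    rewrite subUset; apply/andP; split; apply/subsetP=> f Af; rewrite inE.
      exact: noW.
    by apply/has_typeP=> -[x' [y' [_ _ /collapses_not_aut/negP]]].
  rewrite !inE => /(_ isT)/has_typeP[].
  by exists x, y; rewrite collapses_collapse.
apply/imsetP; exists w => //; rewrite /type_of.
case: pickP => [q wq | /(_ p)]; last by rewrite wp.
by rewrite (has_type_uniq wp wq).
Qed.

Definition type_collapse (p : 'I_r * {set {set gT}}) : End :=
  if [pick xy | [&& stab xy.1 == H p.1, stab xy.2 :^: 'N_G(H p.1) == p.2,
                    xy.2 \notin orb xy.1 & stab xy.1 \subset stab xy.2]]
  is Some xy then collapse xy.1 xy.2 else equi_one to.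

Lemma type_collapse_generate :
  submonoid_gen (EndG to) (type_collapse @: collapse_types :|: AutG to)
    = [set: End].
Proof.
apply: submonoid_gen_fullP => S SM; rewrite subUset => /andP[/subsetP SW SA].
apply: collapses_generate => // x y nxy sxy.
have /imsetP[i _ def_i]: stab x :^: G \in [set H i :^: G | i : 'I_r].
  by rewrite H_list; apply/imsetP; exists x.
have [x' x'x eq_x'] := stab_conj_repr def_i.
case/orbitP: x'x eq_x' => g Gg <- {x'} eq_x.
rewrite -(collapse_conj sxy Gg).
have := stab_sub_conj Gg sxy; have: to y g \notin orb (to x g).
  by rewrite orb_act_base ?orb_act.
move: (to x g) (to y g) eq_x => {g Gg sxy nxy def_i} {}x {}y eq_x nxy sxy.
have Tp := mem_collapse_types nxy eq_x sxy.
have /SW: type_collapse (i, stab y :^: 'N_G(H i)) \in type_collapse @: collapse_types.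
  exact: imset_f.
rewrite /type_collapse; case: pickP => [[x0 y0] | /(_ (x, y))] /=; last first.
  by rewrite eq_x !eqxx nxy -eq_x sxy.
case/and4P=> /eqP eq_x0 /conjugates_eqP[n /setIP[Gn nHn] eq_y] n0 s0.
(* Moving the chosen pair by [n] matches the stabilizers of [y0] and [y], and keeps that of [x0]
   equal to [H i] because [n] normalizes it. *)
rewrite -(collapse_conj s0 Gn) => S0.
have [|||a [b [Aa Ab ->]]] :=
    collapse_same_type (x0 := to x0 n) (y0 := to y0 n) _ nxy sxy _ _.
- by rewrite orb_act_base ?orb_act.
- by rewrite stab_act // eq_x0 eq_x; apply/normP.
- by rewrite stab_act.
have /submonoidP[_ mulS] := SM.
apply: (mulS); first exact: (subsetP SA).
by apply: (mulS); last exact: (subsetP SA).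
Qed.

Lemma relative_rank_types : relative_rank (EndG to) (AutG to) = #|collapse_types|.
Proof.
have [[W genW cardW] minW] := relative_rankP (EndG to) (AutG to).
apply/eqP; rewrite eqn_leq -{2}cardW leq_card_generators // andbT.
by apply: leq_trans (leq_imset_card type_collapse _); apply/minW/type_collapse_generate.
Qed.

Lemma card_collapse_types :
  (#|collapse_types| + kappa to H = \sum_(i < r) #|Uset to (H i)|)%N.
Proof.
pose single i := #|orbits_of_type to (H i)| == 1%N.
pose T i := [set u in Uset to (H i) | ~~ (single i && (u == H i :^: 'N_G(H i)))].
have ->: #|collapse_types| = (\sum_(i < r) #|T i|)%N.
  rewrite -sum1_card; under [RHS]eq_bigr do rewrite -sum1_card.
  by rewrite pair_big_dep /=; apply: eq_bigl => -[i u]; rewrite !inE.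
have ->: kappa to H = (\sum_(i < r) single i)%N.
  rewrite /kappa -sum1_card big_mkcond; apply: eq_bigr => i _.
  by rewrite inE /single; case: ifP.
rewrite -big_split; apply: eq_bigr => i _ /=.
have [x eq_x] := stab_repr i.
rewrite /T; case: (single i); last first.
  by rewrite addn0; apply: eq_card => u; rewrite !inE andbT.
(* The class of [H i] itself always lies in [Uset to (H i)], so exactly one element is lost. *)
rewrite (cardsD1 (H i :^: 'N_G(H i)) (Uset _ _)) addnC; congr (_ + _)%N.
  suff ->: H i :^: 'N_G(H i) \in Uset to (H i) by [].
  by apply/imsetP; exists x; rewrite ?inE eq_x.
by apply: eq_card => u; rewrite !inE andbC.
Qed.

End Types.

End EquivariantMonoid.

Theorem theorem1 (gT : finGroupType) (G : {group gT}) (X : finType)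
  (to : action G X) (r : nat) (H : 'I_r -> {group gT})
  (H_distinct : injective (fun i : 'I_r => (H i :^: G)%g))
  (H_list : [set (H i :^: G)%g | i : 'I_r] = ConjG to) :
  ((relative_rank (EndG to) (AutG to))%:Z =
     (\sum_(i < r) #|Uset to (H i)|)%N%:Z - (kappa to H)%:Z)%R.
Proof.
rewrite (relative_rank_types H_distinct H_list) -(card_collapse_types H_list).
by rewrite PoszD GRing.addrK.
Qed.
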